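(* Let $\theta_0\in H^\beta([0,1]^d)$ for some $\beta>0$, and let $\Pi$ be the $\alpha$-regular Gaussian series prior for some $\alpha>0$. Let $Y^{(n)}=(Y_k^{(n)})_{k\ge1}$ arise from the Gaussian white-noise model in sequence form, $Y_k^{(n)}=\langle\theta_0,\psi_k\rangle_{L^2}+n^{-1/2}Z_k$, $k\ge1$, with $Z_k$ i.i.d. $N(0,1)$. Then, for every $0\le s<\alpha\wedge\beta$ and every sequence $M_n\to\infty$, $$E_{\theta_0}^{(n)}\Big[\Pi\Big(\theta:\|\theta-\theta_0\|_{H^s}>M_n\,n^{-\frac{(\alpha\wedge\beta)-s}{2\alpha+d}}\,\Big|\,Y^{(n)}\Big)\Big]\to0\qquad\text{as }n\to\infty.$$
   Context: Wavelet Sobolev scale. $\{\psi_k\}_{k\ge1}$ is a single-index reordering, by increasing resolution level, of a tensor-product orthonormal wavelet basis of $L^2([0,1]^d)$ built from $S$-regular ($S\in\mathbb N$), compactly supported, boundary-corrected Daubechies wavelets; $\lambda_k=k^{1/d}$. For $s\ge0$, $H^s=H^s([0,1]^d)$ consists of $h=\sum_{k\ge1}h_k\psi_k$ with $\|h\|_{H^s}^2=\sum_{k\ge1}\lambda_k^{2s}h_k^2<\infty$, $h_k=\langle h,\psi_k\rangle_{L^2}$. Prior: $\Pi$ is the law of $\theta=\sum_{k\ge1}\lambda_k^{-\alpha-d/2}t_k\psi_k$, $t_k$ i.i.d. $N(0,1)$; thus $\theta_k=\langle\theta,\psi_k\rangle_{L^2}$ are independent $N(0,\lambda_k^{-2\alpha-d})$.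 Posterior: $\Pi(\cdot|Y^{(n)})$ is the conditional law of $\theta$ given $Y^{(n)}$ when $\theta\sim\Pi$ and, given $\theta$, $Y^{(n)}_k=\theta_k+n^{-1/2}Z_k$ with $Z_k$ i.i.d. $N(0,1)$; explicitly, under it the coordinates $\theta_k$ are independent with $\theta_k\sim N\big(\tfrac{nY_k^{(n)}}{n+\lambda_k^{2\alpha+d}},\tfrac1{n+\lambda_k^{2\alpha+d}}\big)$. $E_{\theta_0}^{(n)}$ is expectation over $Y^{(n)}$ generated with $\theta=\theta_0$. *)

(* Defs.v *)
From HB Require Import structures.
From mathcomp Require Import all_boot all_order all_algebra.
From mathcomp Require Import all_classical all_reals all_analysis.

Set Implicit Arguments.
Unset Strict Implicit.
Unset Printing Implicit Defensive.
Import Order.TTheory GRing.Theory Num.Theory.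
Import numFieldNormedType.Exports.

Local Open Scope classical_set_scope.
Local Open Scope ring_scope.

(** * The space L^2([0,1]^d) *)

Section cube_measure.
Context (R : realType).

(* [lebesgue_measure] and [uniform_prob] live on [measurableTypeR R], which has
   the same measurable sets as [R] but another display. *)
Definition cons_pair (d : nat) (x : measurableTypeR R * d.-tuple R)
    : d.+1.-tuple R :=
  [tuple of (x.1 : R) :: x.2].

Lemma measurable_cons_pair d :
  measurable_fun [set: measurableTypeR R * d.-tuple R] (@cons_pair d).
Proof.
by apply: measurable_cons; [exact: measurable_fst|exact: measurable_snd].
Qed.

HB.instance Definition _ d :=
  isMeasurableFun.Build _ _ _ _ (@cons_pair d) (@measurable_cons_pair d).

(* Lebesgue measure on [0,1]^d, as a probability on R^d carried by the cube:
   the d-fold product of the uniform distribution on [0,1]. *)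
Fixpoint cube (d : nat) : probability (d.-tuple R) R :=
  match d with
  | 0 => \d_([tuple] : 0.-tuple R)
  | d'.+1 =>
      distribution
        (uniform_prob (@ltr01 R) \x cube d' : probability _ R)%E (@cons_pair d')
  end.

Lemma le1_2 : (1 <= 2%:E :> \bar R)%E.
Proof. by rewrite lee_fin ler1n. Qed.

(* The elements are square-integrable functions, not classes modulo a.e.
   equality; equality in L^2 is written [%[ae cube d]]. *)
Definition preL2 (d : nat) : Type := LfunType (cube d) le1_2.
HB.instance Definition _ d := Choice.on (preL2 d).
HB.instance Definition _ d := isPointed.Build (preL2 d) (0 : LfunType (cube d) le1_2).

Definition inner (d : nat) (f g : d.-tuple R -> R) : R :=
  \int[cube d]_x (f x * g x).

(* L^2([0,1]^d) with the sigma-algebra generated by the continuous linear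
   functionals, which is its Borel sigma-algebra since L^2 is separable. *)
Definition L2_cylinders (d : nat) : set (set (preL2 d)) :=
  [set A | exists (g : preL2 d) (B : set R), measurable B /\
           A = [set f : preL2 d | B (inner f g)]].

Definition L2 (d : nat) := g_sigma_algebraType (@L2_cylinders d).

End cube_measure.

(** * Boundary-corrected Daubechies wavelets on [0,1]
    (Cohen, Daubechies & Vial, "Wavelets on the interval and fast wavelet
    transforms", 1993) *)

Section wavelets.
Context (R : realType).
Local Notation mu := (@lebesgue_measure R).

(* In all functions below the boolean is [false] for scaling functions and
   [true] for wavelets. *)
Record interval_wavelets := IntervalWavelets {
  nmoments : nat;                     (* N, the number of vanishing moments *)
  coarsest : nat;                     (* J0, the coarsest resolution level *)
  filter_coef : nat -> R;             (* [filter_coef i] is h_(i - N + 1) *)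
  mother : bool -> R -> R;            (* the Daubechies pair on the line *)
  left_edge : bool -> nat -> R -> R;  (* N edge functions at 0 *)
  right_edge : bool -> nat -> R -> R  (* N edge functions at 0 from the left,
                                         shifted to 1 in [interval_fun] *)
}.

(* The [k]-th function at level [j], for [k < 2 ^ j]. *)
Definition interval_fun (w : interval_wavelets) (e : bool) (j k : nat) (x : R)
    : R :=
  let N := nmoments w in
  Num.sqrt (2 ^+ j) *
  (if (k < N)%N then left_edge w e k (2 ^+ j * x)
   else if (k < 2 ^ j - N)%N then mother w e (2 ^+ j * x - k%:R)
   else right_edge w e (2 ^ j - 1 - k) (2 ^+ j * (x - 1))).

Definition Ck (S : nat) (f : R -> R) :=
  (forall i, (i <= S)%N -> continuous (derive1n i f)) /\
  (forall i x, (i < S)%N -> derivable (derive1n i f) x 1).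

(* The orthonormal Daubechies pair (phi, psi) with a filter of length 2N and
   N vanishing moments, translated so that the supports are in [-N+1, N]:
     phi(x) = sqrt 2 * sum_(m = -N+1)^N h_m phi(2x - m),
     psi(x) = sqrt 2 * sum_(m = -N+1)^N (-1)^m h_(1-m) phi(2x - m). *)
Record daubechies (S : nat) (w : interval_wavelets) : Prop := {
  daub_order : (0 < nmoments w)%N;
  daub_regular : Ck S (mother w false);
  daub_support : forall x : R, (x < 1 - (nmoments w)%:R \/ (nmoments w)%:R < x) ->
    mother w false x = 0;
  daub_mass : \int[mu]_x mother w false x = 1;
  daub_orthonormal : forall m : int,
    \int[mu]_x (mother w false x * mother w false (x - m%:~R)) = (m == 0)%:R;
  daub_refinement : forall x, mother w false x =
    Num.sqrt 2 * \sum_(i < (nmoments w).*2)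
      filter_coef w i * mother w false (2 * x - (i%:R - (nmoments w)%:R + 1));
  daub_wavelet : forall x, mother w true x =
    Num.sqrt 2 * \sum_(i < (nmoments w).*2)
      (-1) ^+ (i + nmoments w + 1) * filter_coef w ((nmoments w).*2 - 1 - i) *
      mother w false (2 * x - (i%:R - (nmoments w)%:R + 1));
  daub_moments : forall l, (l < nmoments w)%N ->
    \int[mu]_x (x ^+ l * mother w true x) = 0
}.

(* The edge functions are compactly supported finite combinations of dyadic
   translates of phi cut at the end point, chosen so that the scaling
   functions of each level still reproduce the polynomials of degree < N on
   [0,1]. Orthonormality is part of [wavelet_basis]. *)
Record boundary_corrected (w : interval_wavelets) : Prop := {
  bc_coarsest : ((nmoments w).*2 <= 2 ^ coarsest w)%N;
  bc_left_support : forall e k (x : R), (k < nmoments w)%N ->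
    (x < 0 \/ (nmoments w).*2%:R - 1 < x) -> left_edge w e k x = 0;
  bc_right_support : forall e k (x : R), (k < nmoments w)%N ->
    (0 < x \/ x < - ((nmoments w).*2%:R - 1)) -> right_edge w e k x = 0;
  bc_left : forall e k, (k < nmoments w)%N -> exists (s : seq int) (c : int -> R),
    forall x : R, 0 <= x -> left_edge w e k x =
      \sum_(m <- s) c m * mother w false ((if e then 2 else 1) * x - m%:~R);
  bc_right : forall e k, (k < nmoments w)%N -> exists (s : seq int) (c : int -> R),
    forall x : R, x <= 0 -> right_edge w e k x =
      \sum_(m <- s) c m * mother w false ((if e then 2 else 1) * x - m%:~R);
  bc_polynomials : forall j l, (coarsest w <= j)%N -> (l < nmoments w)%N ->
    exists c : nat -> R, forall x : R, 0 <= x <= 1 ->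
      x ^+ l = \sum_(k < 2 ^ j) c k * interval_fun w false j k x
}.

(* Indices (j, e, k) of the tensor-product basis: resolution level, type in
   each coordinate, position in each coordinate. The pure tensor products of
   scaling functions occur at the coarsest level only. *)
Definition wavelet_index (d : nat) : Type :=
  (nat * {ffun 'I_d -> bool} * {ffun 'I_d -> nat})%type.

Definition valid_index (d : nat) (w : interval_wavelets) (i : wavelet_index d)
    : Prop :=
  let: (j, e, k) := i in
  [/\ (coarsest w <= j)%N,
      (exists a, e a) \/ j = coarsest w
    & forall a, (k a < 2 ^ j)%N].

Definition tensor_fun (d : nat) (w : interval_wavelets) (i : wavelet_index d)
    (x : d.-tuple R) : R :=
  let: (j, e, k) := i in
  \prod_(a < d) interval_fun w (e a) j (k a) (tnth x a).

Definition orthonormal_basis (d : nat) (psi : nat -> L2 R d) : Prop :=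
  (forall j k, inner (psi j) (psi k) = (j == k)%:R) /\
  (forall f : L2 R d, (forall k, inner f (psi k) = 0) ->
     (f : d.-tuple R -> R) = cst 0 %[ae cube R d]).

(* [psi k] is the (k+1)-st basis function: indices start at 0. *)
Definition wavelet_basis (d S : nat) (psi : nat -> L2 R d) : Prop :=
  exists (w : interval_wavelets) (idx : nat -> wavelet_index d),
    [/\ daubechies S w /\ boundary_corrected w,
        injective idx /\ (forall i, valid_index w i <-> exists k, idx k = i),
        (forall k l, (k <= l)%N -> ((idx k).1.1 <= (idx l).1.1)%N),
        (forall k x, (forall a, 0 <= tnth x a <= 1) ->
           psi k x = tensor_fun w (idx k) x)
      & orthonormal_basis psi].

End wavelets.

(** * Sobolev scale *)

Section sobolev.
Context (R : realType) (d : nat) (psi : nat -> L2 R d).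

(* k^(1/d) for the 1-based index k. *)
Definition lambda (k : nat) : R := k.+1%:R `^ (d%:R^-1).

Definition coef (f : d.-tuple R -> R) (k : nat) : R := inner f (psi k).

(* Equal to +oo when [f] is not in H^s. *)
Definition sobolev_norm (s : R) (f : d.-tuple R -> R) : \bar R :=
  ((\sum_(0 <= k <oo) (lambda k `^ (2 * s) * coef f k ^+ 2)%:E) `^ 2^-1)%E.

Definition sobolev (s : R) : set (L2 R d) :=
  [set f | (sobolev_norm s f < +oo)%E].

End sobolev.

(** * Prior, observations, posterior *)

Section probability.
Context (R : realType).

Definition mutually_independent (dT : measure_display) (T : measurableType dT)
    (P : {measure set T -> \bar R}) (X : nat -> T -> R) : Prop :=
  forall (J : seq nat) (A : nat -> set R), uniq J ->
    (forall k, measurable (A k)) ->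
    P (\bigcap_(k in [set` J]) X k @^-1` A k) =
    (\prod_(k <- J) P (X k @^-1` A k))%E.

(* [normal_prob m s] has mean m and standard deviation s. *)
Definition independent_normals (dT : measure_display) (T : measurableType dT)
    (P : {measure set T -> \bar R}) (X : nat -> T -> R) (mean sd : nat -> R)
    : Prop :=
  mutually_independent P X /\
  forall k A, measurable A -> P (X k @^-1` A) = normal_prob (mean k) (sd k) A.

Definition iid_std_normal (dT : measure_display) (T : measurableType dT)
    (P : probability T R) (X : nat -> {RV P >-> R}) : Prop :=
  independent_normals P (fun k => X k : T -> R) (fun=> 0) (fun=> 1).

(* Real sequences with the product sigma-algebra. *)
Definition sequence_cylinders : set (set (nat -> R)) :=
  [set A | exists (k : nat) (B : set R), measurable B /\
           A = [set y : nat -> R | B (y k)]].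

Definition Rseq := g_sigma_algebraType sequence_cylinders.

End probability.

Section bayes.
Context (R : realType) (d : nat) (psi : nat -> L2 R d) (alpha : R).

(* [Pi] is the law of the L^2-valued random series
   sum_k lambda_k^(-alpha-d/2) t_k psi_k with t_k i.i.d. N(0,1). *)
Definition gaussian_series_prior (Pi : probability (L2 R d) R) : Prop :=
  exists (dT : measure_display) (T : measurableType dT) (Q : probability T R)
    (t : nat -> {RV Q >-> R}) (theta : {RV Q >-> L2 R d}),
    [/\ iid_std_normal t,
        {ae Q, forall w,
          Lnorm (cube R d) 2%:E (EFin \o (fun x => theta w x -
             \sum_(k < K) lambda R d k `^ (- alpha - d%:R / 2) * t k w * psi k x))
          @[K --> \oo] --> 0%E}
      & forall A, measurable A -> Pi A = distribution Q theta A].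

Context (dW : measure_display) (W : measurableType dW) (P : probability W R)
  (Z : nat -> {RV P >-> R}).

Definition observation (n : nat) (theta : L2 R d) (w : W) : Rseq R :=
  fun k => coef psi theta k + (Num.sqrt n%:R)^-1 * Z k w.

Definition precision (n k : nat) : R :=
  n%:R + lambda R d k `^ (2 * alpha + d%:R).

Definition posterior_mean (n : nat) (y : Rseq R) (k : nat) : R :=
  n%:R * y k / precision n k.

(* A regular version of the conditional law of theta given the observations
   in the Bayesian model. As such it is determined only up to null sets of
   observations; [post_explicit] fixes it by the usual conjugacy formula at
   every [y] for which that formula defines a law on L^2, namely when the
   posterior means are square-summable (this holds for almost all
   observations; the posterior variances are always summable). *)
Record posterior (Pi : probability (L2 R d) R) (n : nat)
    (post : R.-pker (Rseq R) ~> (L2 R d)) : Prop := {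
  post_conditional : forall (A : set (L2 R d)) (B : set (Rseq R)),
    measurable A -> measurable B ->
    (\int[Pi]_theta \int[P]_w
       (post (observation n theta w) A *
        (\1_B (observation n theta w))%:E) =
     \int[Pi]_(theta in A) P [set w | B (observation n theta w)])%E;
  post_explicit : forall y : Rseq R,
    (\sum_(0 <= k <oo) (posterior_mean n y k ^+ 2)%:E < +oo)%E ->
    independent_normals (post y) (fun k theta => coef psi theta k)
      (posterior_mean n y) (fun k => Num.sqrt (precision n k)^-1)
}.

End bayes.

(* Main.v *)
Require Import Defs.
From mathcomp Require Import all_boot all_order all_algebra.
From mathcomp Require Import all_classical all_reals all_analysis measurable_realfun.
From mathcomp Require Import ring lra.

(** Write gamma for min(alpha, beta) and a for 2 alpha + d. By Markov's inequality
    it is enough that, averaged over the observations, the posterior expectation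
    of the squared distance
      sum_k lambda_k^(2s) (theta_k - theta0_k)^2
    is at most C n^(-2 (gamma - s) / a): dividing by the squared radius
    M_n^2 n^(-2 (gamma - s) / a) leaves C / M_n^2, which tends to 0.

    This reduces to second moments of single coordinates. Under the
    posterior, theta_k is normal with variance 1 / p_k, where
    p_k = n + lambda_k^a, and its mean differs from theta0_k by the shrinkage
    bias (lambda_k^a / p_k) theta0_k and by a noise term of variance n / p_k^2,
    itself at most 1 / p_k. Two deterministic estimates remain.
    - Variance: sum_k lambda_k^(2s) / p_k = O(n^(-2 (alpha - s) / a)). With
      lambda_k = k^(1/d) and T = n^(d/a), each summand is at most a constant
      times (T + k)^(-1 - delta), where delta = 2 (alpha - s) / d, and the sum
      of these is compared with a telescoping one
      ([powR_ratio_series_le], [posterior_variance_series_le]).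
    - Bias: lambda_k^(2s) (lambda_k^a / p_k)^2 <= lambda_k^(2 beta) n^(-2 (gamma - s) / a)
      termwise, by an elementary inequality between powers, and
      sum_k lambda_k^(2 beta) theta0_k^2 is finite
      ([shrinkage_bias_le], [weighted_bias_le]).

    The conjugate description of the posterior is available only at observations
    whose posterior means are square-summable. This costs nothing: at all other
    observations the bound on the posterior expectation is infinite
    ([integral_sobolev_sqdist_le]). *)

Set Implicit Arguments.
Unset Strict Implicit.
Unset Printing Implicit Defensive.
Import Order.TTheory GRing.Theory Num.Theory.
Import numFieldNormedType.Exports.

Local Open Scope classical_set_scope.
Local Open Scope ring_scope.

(** * Second moments of normal laws *)

Section normal_second_moment.
Context (R : realType).
Local Notation mu := (@lebesgue_measure R).

(** The density of the normal law agrees almost everywhere with its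
    Radon-Nikodym derivative, for which the change of variables is known. *)
Lemma ge0_integral_normal_prob (m s : R) (f : measurableTypeR R -> \bar R) :
  measurable_fun [set: measurableTypeR R] f -> (forall x, 0 <= f x)%E ->
  (\int[normal_prob m s]_x f x = \int[mu]_x (f x * (normal_pdf m s x)%:E))%E.
Proof.
move=> mf f0; have dom := normal_prob_dominates m s.
rewrite -(Radon_Nikodym_SigmaFinite.change_of_variables dom)//.
have int_rn := Radon_Nikodym_SigmaFinite.f_integrable dom.
have mpdf : measurable_fun [set: measurableTypeR R]
    (EFin \o normal_pdf m s).
  apply/measurable_EFinP; exact: measurable_normal_pdf.
apply: ae_eq_integral => //.
- apply: emeasurable_funM => //; first exact: (measurable_int mu int_rn).
- by apply: emeasurable_funM.
- apply: ae_eqe_mul2l; apply: integral_ae_eq => // E _ mE.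
  by rewrite -Radon_Nikodym_SigmaFinite.f_integral.
Qed.

(** A polynomial factor is absorbed by doubling the standard deviation. This
    reduces a second moment to a total mass, up to a constant factor. *)
Lemma sqr_normal_pdf_le (m s x : R) : 0 < s ->
  (x - m) ^+ 2 * normal_pdf m s x <= 8 * s ^+ 2 * normal_pdf m (2 * s) x.
Proof.
move=> s0; rewrite !normal_pdfE ?gt_eqF ?mulr_gt0//.
have -> : normal_peak (2 * s) = normal_peak s / 2.
  rewrite /normal_peak exprMn -mulrA -mulrnAr sqrtrM ?exprn_ge0//.
  by rewrite sqrtr_sqr ger0_norm// invfM mulrC.
set u := (x - m) ^+ 2; set v := (8 * s ^+ 2)^-1.
have v0 : 0 < v by rewrite invr_gt0 mulr_gt0 ?exprn_gt0.
have E1 : normal_fun m (2 * s) x = expR (- (u * v)).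
  rewrite /normal_fun -/u /v; congr expR.
  rewrite mulNr; congr (- (_ / _)); rewrite -mulr_natr; ring.
have E2 : normal_fun m s x = expR (- (u * v)) * expR (- (3 * (u * v))).
  rewrite /normal_fun -/u /v -expRD; congr expR.
  by field; rewrite gt_eqF.
rewrite E1 E2 [leLHS](_ : _ = normal_peak s * expR (- (u * v)) *
  (u * expR (- (3 * (u * v))))); last by ring.
rewrite [leRHS](_ : _ = normal_peak s * expR (- (u * v)) * (4 * s ^+ 2)); last by field.
apply: ler_wpM2l; first by rewrite mulr_ge0 ?normal_peak_ge0 ?expR_ge0.
rewrite expRN ler_pdivrMr ?expR_gt0//.
(* with t := u * v the claim is 2 t <= exp (3 t) *)
have uE : u = 8 * s ^+ 2 * (u * v) by rewrite /v; field; rewrite gt_eqF.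
have t0 : 0 <= u * v by rewrite mulr_ge0 ?sqr_ge0// ltW.
rewrite {1}uE [8](_ : _ = 4 * 2); last by ring.
rewrite -![4 * _ * _]mulrA ler_pM2l// mulrAC mulrC ler_pM2l ?exprn_gt0//.
by have := expR_ge1Dx (3 * (u * v)); lra.
Qed.

Lemma integral_sqrB_normal_prob_le (m s c : R) : 0 < s ->
  (\int[normal_prob m s]_x ((x - c) ^+ 2)%:E
    <= (16 * s ^+ 2 + 2 * (m - c) ^+ 2)%:E)%E.
Proof.
move=> s0.
have msq b : measurable_fun [set: measurableTypeR R]
    (fun x => ((x - b) ^+ 2)%:E).
  by apply/measurable_EFinP/measurable_funX; exact: measurable_funB.
have var : (\int[normal_prob m s]_x ((x - m) ^+ 2)%:E <= (8 * s ^+ 2)%:E)%E.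
  rewrite ge0_integral_normal_prob//; last by move=> x; rewrite lee_fin sqr_ge0.
  apply: (@le_trans _ _ (\int[mu]_x ((8 * s ^+ 2)%:E *
      (normal_pdf m (2 * s) x)%:E))%E).
    apply: ge0_le_integral => //.
    - by move=> x _; rewrite mule_ge0 ?lee_fin ?sqr_ge0 ?normal_pdf_ge0.
    - by apply: emeasurable_funM => //; apply/measurable_EFinP; exact: measurable_normal_pdf.
    - by apply: emeasurable_funM => //; apply/measurable_EFinP; exact: measurable_normal_pdf.
    - by move=> x _; rewrite -!EFinM lee_fin sqr_normal_pdf_le.
  rewrite ge0_integralZl//.
  - by rewrite integral_normal_pdf mule1.
  - apply/measurable_EFinP; exact: measurable_normal_pdf.
  - by move=> x _; rewrite lee_fin normal_pdf_ge0.
  - by rewrite lee_fin mulr_ge0// sqr_ge0.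
apply: (@le_trans _ _ (\int[normal_prob m s]_x
   (2%:E * ((x - m) ^+ 2)%:E + (2 * (m - c) ^+ 2)%:E))%E).
  apply: ge0_le_integral => //.
  - by move=> x _; rewrite lee_fin sqr_ge0.
  - by apply: emeasurable_funD => //; apply: emeasurable_funM.
  - move=> x _; rewrite -EFinM -EFinD lee_fin -subr_ge0.
    have -> : 2 * (x - m) ^+ 2 + 2 * (m - c) ^+ 2 - (x - c) ^+ 2 =
      (x - m - (m - c)) ^+ 2 by ring.
    exact: sqr_ge0.
rewrite ge0_integralD//.
- rewrite ge0_integralZl//; last by move=> x _; rewrite lee_fin sqr_ge0.
  rewrite [X in (_ + X <= _)%E](integral_cst _ measurableT (2 * (m - c) ^+ 2)%:E).
  rewrite [X in (_ + _ * X <= _)%E](_ : _ = 1%E); last exact: integral_normal_pdf.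
  rewrite mule1 [leRHS]EFinD leeD2r// (_ : 16 * s ^+ 2 = 2 * (8 * s ^+ 2)); last by ring.
  by rewrite [leRHS]EFinM lee_pmul2l.
- by move=> x _; rewrite -EFinM lee_fin mulr_ge0 ?sqr_ge0.
- by apply: emeasurable_funM.
- by move=> x _; rewrite lee_fin mulr_ge0 ?sqr_ge0.
Qed.

(** The form in which normality is used: the law of [X] is prescribed on
    measurable sets only, and the second moment may be taken about any point. *)
Lemma integral_sqrB_normal_law_le d (T : measurableType d)
    (P : {measure set T -> \bar R}) (X : T -> R) (m s c : R) : 0 < s ->
  measurable_fun [set: T] X ->
  (forall A, measurable A -> P (X @^-1` A) = normal_prob m s A) ->
  (\int[P]_t ((X t - c) ^+ 2)%:E <= (16 * s ^+ 2 + 2 * (m - c) ^+ 2)%:E)%E.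
Proof.
move=> s0 mX lawX.
have mX' : measurable_fun [set: T] (X : T -> measurableTypeR R) by exact: mX.
apply: le_trans (integral_sqrB_normal_prob_le m c s0).
rewrite -(@eq_measure_integral _ _ _ _ _
  (pushforward P (X : T -> measurableTypeR R))); last first.
  by move=> A mA _; exact: lawX.
rewrite [leRHS]ge0_integral_pushforward//; last 2 first.
- apply/measurable_EFinP/measurable_funX; exact: measurable_funB.
- by move=> x _; rewrite lee_fin sqr_ge0.
Qed.

End normal_second_moment.

(** * Estimates of sums of powers *)

Section power_sums.
Context (R : realType).
Implicit Types (T del q p N : R) (k : nat).

(** The discrete counterpart of the convexity of x^(-del): the drop over a unit
    interval is at least the slope at its right end. It follows from
    (1 - 1/y)^(-del) >= 1 + del/y, a consequence of ln (1 - h) <= - h. *)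
Lemma powR_telescope_ge (T del : R) k : 0 < T -> 0 < del ->
  (T + k.+1%:R) `^ (- 1 - del) * del <=
  (T + k%:R) `^ (- del) - (T + k.+1%:R) `^ (- del).
Proof.
move=> T0 d0; set x := T + k%:R.
have x0 : 0 < x by rewrite ltr_wpDr.
have -> : T + k.+1%:R = x + 1 by rewrite /x -natr1 addrA.
set y := x + 1; have y0 : 0 < y by rewrite ltr_wpDr.
have yl : y `^ (- 1 - del) = y `^ (- del) * y^-1.
  rewrite powRD; last by apply/implyP => _; rewrite gt_eqF.
  by rewrite powR_inv1 1?mulrC// ltW.
have xl : x `^ (- del) = y `^ (- del) * (x / y) `^ (- del).
  by rewrite -powRM ?ltW ?divr_gt0// mulrC divfK// gt_eqF.
have bern : 1 + del / y <= (x / y) `^ (- del).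
  rewrite /powR gt_eqF ?divr_gt0//.
  apply: le_trans (expR_ge1Dx _); rewrite lerD2l mulNr -mulrN.
  apply: ler_wpM2l; first exact: ltW.
  rewrite lerNr (_ : x / y = 1 + - y^-1).
    by apply: le_ln1Dx; rewrite ltrN2 invf_lt1// /y; lra.
  by rewrite (_ : x = y - 1) ?mulrBl ?divff ?mul1r ?gt_eqF// /y addrK.
rewrite xl yl -[leRHS]/(_ + _) -{3}[y `^ (- del)]mulr1 -mulrBr -mulrA ler_wpM2l ?powR_ge0//.
by rewrite lerBrDl [y^-1 * _]mulrC.
Qed.

Lemma shifted_powR_series_le (T del : R) : 0 < T -> 0 < del ->
  (\sum_(0 <= k <oo) ((T + k.+1%:R) `^ (- 1 - del))%:E
    <= (T `^ (- del) / del)%:E)%E.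
Proof.
move=> T0 d0; apply: lime_le.
  by apply: is_cvg_nneseries => k _ _; rewrite lee_fin powR_ge0.
apply: nearW => m; rewrite sumEFin lee_fin ler_pdivlMr// mulr_suml.
apply: (@le_trans _ _ (\sum_(0 <= k < m)
    ((T + k%:R) `^ (- del) - (T + k.+1%:R) `^ (- del)))).
  by apply: ler_sum => k _; exact: powR_telescope_ge.
under eq_bigr do rewrite -opprB.
by rewrite sumrN telescope_sumr// opprB addr0 gerBl powR_ge0.
Qed.

(** T^p + x^p is comparable to (T + x)^p, so that the regimes x <= T and T <= x
    need not be separated when summing over x. *)
Lemma powR_ratio_le (x T p q : R) : 0 < x -> 0 < T -> 0 <= q -> 0 <= p ->
  x `^ q / (T `^ p + x `^ p) <= 2 `^ p * (T + x) `^ (q - p).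
Proof.
move=> x0 T0 q0 p0; set y := T + x.
have y0 : 0 < y by rewrite addr_gt0.
have ypow : y `^ p <= 2 `^ p * (T `^ p + x `^ p).
  have [leTx|ltxT] := leP T x.
    apply: (@le_trans _ _ ((2 * x) `^ p)).
      by apply: ge0_ler_powR => //; rewrite ?nnegrE /y; lra.
    by rewrite powRM ?(ltW x0)// ler_wpM2l ?powR_ge0// lerDr powR_ge0.
  apply: (@le_trans _ _ ((2 * T) `^ p)).
    by apply: ge0_ler_powR => //; rewrite ?nnegrE /y; lra.
  by rewrite powRM ?(ltW T0)// ler_wpM2l ?powR_ge0// lerDl powR_ge0.
rewrite ler_pdivrMr ?addr_gt0 ?powR_gt0//.
rewrite powRB; last by apply/implyP => _; rewrite gt_eqF.
rewrite [leRHS](_ : _ = y `^ q * (2 `^ p * (T `^ p + x `^ p)) / y `^ p);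
  last by ring.
rewrite ler_pdivlMr ?powR_gt0//.
apply: ler_pM; rewrite ?powR_ge0//.
by apply: ge0_ler_powR => //; rewrite ?nnegrE /y; lra.
Qed.

(** The threshold T = N^(1/p) is where N and k^p balance. *)
Lemma powR_ratio_series_le (N p q : R) : 0 < N -> 0 <= q -> q < p - 1 ->
  (\sum_(0 <= k <oo) (k.+1%:R `^ q / (N + k.+1%:R `^ p))%:E
    <= (2 `^ p / (p - 1 - q) * N `^ (- ((p - 1 - q) / p)))%:E)%E.
Proof.
move=> N0 q0 qp; have p0 : 0 < p by lra.
set T := N `^ p^-1; have T0 : 0 < T by rewrite powR_gt0.
have NT : N = T `^ p by rewrite -powRrM mulVf ?powRr1 ?ltW ?gt_eqF.
set del := p - 1 - q; have d0 : 0 < del by rewrite /del; lra.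
apply: (@le_trans _ _ (\sum_(0 <= k <oo)
    ((2 `^ p)%:E * ((T + k.+1%:R) `^ (- 1 - del))%:E))%E).
  apply: lee_nneseries => k.
    by move=> _ _; rewrite lee_fin divr_ge0 ?addr_ge0 ?powR_ge0 ?ltW.
  move=> _; rewrite -EFinM lee_fin {1}NT.
  rewrite (_ : - 1 - del = q - p); last by rewrite /del; lra.
  by apply: powR_ratio_le => //; exact: ltW.
rewrite nneseriesZl; last by move=> k _; rewrite lee_fin powR_ge0.
have -> : N `^ (- (del / p)) = T `^ (- del) 
  by rewrite -powRrM mulrN [p^-1 * _]mulrC.
rewrite [X in (_ <= X%:E)%E](_ : _ = 2 `^ p * (T `^ (- del) / del)); last by ring.
rewrite [leRHS]EFinM lee_pmul2l ?lte_fin ?powR_gt0//.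
exact: shifted_powR_series_le.
Qed.

(** With u = x / N this says u^(2 - c) <= (1 + u)^2, which holds since
    0 <= 2 - c <= 2. The bound c <= 2 is the saturation of the bias. *)
Lemma shrinkage_bias_le (N c x : R) : 0 < N -> 0 < x -> 0 <= c <= 2 ->
  x `^ (- c) * (x / (N + x)) ^+ 2 <= N `^ (- c).
Proof.
move=> N0 x0 /andP[c0 c2].
have S0 : 0 < N + x by rewrite addr_gt0.
have S0' : 0 < (N + x) ^+ 2 by rewrite exprn_gt0.
rewrite expr_div_n mulrA ler_pdivrMr//.
have sq y : 0 < y -> y ^+ 2 = y `^ c * y `^ (2 - c).
  move=> y0; rewrite -powRD; last by apply/implyP => _; rewrite gt_eqF.
  by rewrite addrC subrK powR_mulrn// ltW.
rewrite (sq x)// mulrA powRN mulVf ?gt_eqF ?powR_gt0// mul1r.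
rewrite (sq (N + x))// mulrA powRN.
apply: (@le_trans _ _ ((N + x) `^ (2 - c))).
  by apply: ge0_ler_powR; rewrite ?nnegrE; lra.
rewrite ler_peMl ?powR_ge0// ler_pdivlMl ?powR_gt0// mulr1.
by apply: ge0_ler_powR; rewrite ?nnegrE; lra.
Qed.

End power_sums.

(** * Variance and bias in the Sobolev scale *)

Section sobolev_sums.
Context (R : realType) (d : nat) (d_gt0 : (0 < d)%N).
Implicit Types (x s alpha : R) (k n : nat).
Local Notation lam := (lambda R d).

Lemma lambda_ge1 k : 1 <= lam k.
Proof.
by rewrite /lambda -[leLHS](powRr0 k.+1%:R) ler_powR ?invr_ge0// ler1n.
Qed.

Lemma lambda_gt0 k : 0 < lam k.
Proof. exact: lt_le_trans (lambda_ge1 k). Qed.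

Lemma lambda_powRE k x : lam k `^ x = k.+1%:R `^ (x / d%:R).
Proof. by rewrite /lambda -powRrM mulrC. Qed.

Lemma precision_gt0 alpha n k : 0 < precision d alpha n k.
Proof. by rewrite ltr_wpDl// powR_gt0// lambda_gt0. Qed.

Lemma le_precision alpha n k : n%:R <= precision d alpha n k.
Proof. by rewrite lerDl powR_ge0. Qed.

(** In terms of the index k the summand is k^q / (n + k^p) with q = 2 s / d and
    p = (2 alpha + d) / d; the series converges because s < alpha. *)
Lemma posterior_variance_series_le alpha s : 0 <= s -> s < alpha ->
  exists2 C : R, 0 <= C & forall n, (0 < n)%N ->
    (\sum_(0 <= k <oo) (lam k `^ (2 * s) / precision d alpha n k)%:E <=
      (C * n%:R `^ (- (2 * ((alpha - s) / (2 * alpha + d%:R)))))%:E)%E.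
Proof.
move=> s0 sa; have dR : 0 < d%:R :> R by rewrite ltr0n.
pose p := (2 * alpha + d%:R) / d%:R; pose q := 2 * s / d%:R.
have pqE : p - 1 - q = 2 * (alpha - s) / d%:R.
  by rewrite /p /q; field; rewrite gt_eqF.
have pq0 : 0 < p - 1 - q.
  by rewrite pqE divr_gt0// mulr_gt0// subr_gt0.
exists (2 `^ p / (p - 1 - q)); first by rewrite divr_ge0 ?powR_ge0// ltW.
move=> n n0.
have -> : 2 * ((alpha - s) / (2 * alpha + d%:R)) = (p - 1 - q) / p.
  have a0 : 0 < 2 * alpha + d%:R by lra.
  by rewrite pqE /p; field; rewrite !gt_eqF.
have q0 : 0 <= q by rewrite divr_ge0 ?mulr_ge0// ltW.
have n0R : 0 < n%:R :> R by rewrite ltr0n.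
have qp : q < p - 1 by lra.
apply: le_trans (powR_ratio_series_le n0R q0 qp).
apply: lee_nneseries => k.
  by move=> _ _; rewrite lee_fin divr_ge0 ?powR_ge0// ltW// precision_gt0.
by move=> _; rewrite lee_fin /precision !lambda_powRE.
Qed.

(** [shrinkage_bias_le] for x = lambda_k^a and c = 2 (gamma - s) / a. Smoothness
    of theta0 beyond alpha brings no gain, hence the minimum; it enters through
    lambda_k^(2 gamma) <= lambda_k^(2 beta). *)
Lemma weighted_bias_le alpha beta s n k : 0 <= s -> s < Num.min alpha beta ->
    (0 < n)%N ->
  lam k `^ (2 * s) * (lam k `^ (2 * alpha + d%:R) / precision d alpha n k) ^+ 2
  <= lam k `^ (2 * beta) *
     n%:R `^ (- (2 * ((Num.min alpha beta - s) / (2 * alpha + d%:R)))).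
Proof.
set g := Num.min alpha beta => s0 sg n0.
have ga : g <= alpha by rewrite /g ge_min lexx.
have gb : g <= beta by rewrite /g ge_min lexx orbT.
have dR : 0 < d%:R :> R by rewrite ltr0n.
set a := 2 * alpha + d%:R; have a0 : 0 < a by rewrite /a; lra.
set c := 2 * ((g - s) / a).
have c02 : 0 <= c <= 2.
  rewrite /c; apply/andP; split.
    by rewrite mulr_ge0// divr_ge0//; lra.
  by rewrite -[leRHS]mulr1 ler_pM2l// ler_pdivrMr// mul1r /a; lra.
have l0 := lambda_gt0 k; have la0 : 0 < lam k `^ a by rewrite powR_gt0.
have n0R : 0 < n%:R :> R by rewrite ltr0n.
have -> : lam k `^ (2 * s) = lam k `^ (2 * g) * (lam k `^ a) `^ (- c).
  rewrite -powRrM -powRD; last by apply/implyP => _; rewrite gt_eqF.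
  by congr (_ `^ _); rewrite /c; field; rewrite gt_eqF.
rewrite -mulrA; apply: ler_pM; rewrite ?powR_ge0//.
- by rewrite mulr_ge0 ?powR_ge0 ?sqr_ge0.
- by rewrite ler_powR ?lambda_ge1// ler_pM2l.
- exact: shrinkage_bias_le.
Qed.

End sobolev_sums.

(** * The squared Sobolev distance *)

Section sobolev_distance.
Context (R : realType) (d : nat) (psi : nat -> L2 R d).
Implicit Types (theta : L2 R d) (s r : R).
Local Notation lam := (lambda R d).

Lemma coefB theta theta0 k :
  coef psi (fun x => theta x - theta0 x) k = coef psi theta k - coef psi theta0 k.
Proof.
have intM (f g : L2 R d) :
    (cube R d).-integrable [set: d.-tuple R] (EFin \o (fun x => f x * g x)).
  by apply/Lfun1_integrable/Lfun2_mul_Lfun1; exact: LfunP.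
rewrite /coef /inner -RintegralB//.
by apply: eq_Rintegral => x _; rewrite mulrBl.
Qed.

(** Coefficients are among the functionals generating the sigma-algebra. *)
Lemma measurable_coef k : measurable_fun [set: L2 R d] (fun theta => coef psi theta k).
Proof.
move=> _ B mB; rewrite setTI; apply: sub_sigma_algebra.
by exists (psi k), B.
Qed.

Definition sobolev_sqdist s (theta0 theta : L2 R d) : \bar R :=
  (\sum_(0 <= k <oo)
    (lam k `^ (2 * s) * (coef psi theta k - coef psi theta0 k) ^+ 2)%:E)%E.

Lemma sobolev_sqdist_ge0 s theta0 theta : (0 <= sobolev_sqdist s theta0 theta)%E.
Proof.
by apply: nneseries_ge0 => k _ _; rewrite lee_fin mulr_ge0 ?powR_ge0 ?sqr_ge0.
Qed.

Lemma sobolev_norm_gtE s r theta0 theta : 0 <= r ->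
  (r%:E < sobolev_norm psi s (fun x => (theta x - theta0 x)%R))%E =
  ((r ^+ 2)%:E < sobolev_sqdist s theta0 theta)%E.
Proof.
move=> r0; have -> : r%:E = sqrte (r ^+ 2)%:E by rewrite /= sqrtr_sqr ger0_norm.
rewrite /sobolev_norm; under eq_eseriesr do rewrite coefB.
rewrite -/(sobolev_sqdist s theta0 theta) poweR12_sqrt ?sobolev_sqdist_ge0//.
by rewrite !ltNge lee_sqrt// lee_fin sqr_ge0.
Qed.

Lemma measurable_sobolev_sqdist s theta0 :
  measurable_fun [set: L2 R d] (sobolev_sqdist s theta0).
Proof.
apply: ge0_emeasurable_sum => k.
  by move=> theta _ _; rewrite lee_fin mulr_ge0 ?powR_ge0 ?sqr_ge0.
move=> _; apply/measurable_EFinP/measurable_funM => //.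
by apply/measurable_funX/measurable_funB => //; exact: measurable_coef.
Qed.

End sobolev_distance.

(** * Posterior risk *)

Section posterior_risk.
Context (R : realType) (d : nat) (psi : nat -> L2 R d) (alpha : R).
Implicit Types (theta : L2 R d) (s beta r : R) (y : Rseq R).
Local Notation lam := (lambda R d).
Local Notation prec := (precision d alpha).
Local Notation pmean := (posterior_mean d alpha).

Lemma sobolev_summable beta theta0 : sobolev psi beta theta0 ->
  (\sum_(0 <= k <oo) (lam k `^ (2 * beta) * coef psi theta0 k ^+ 2)%:E < +oo)%E.
Proof. by apply: lty_poweRy; rewrite invr_neq0. Qed.

Lemma sobolev_coef_sqr_summable beta theta0 : 0 <= beta ->
    sobolev psi beta theta0 ->
  (\sum_(0 <= k <oo) (coef psi theta0 k ^+ 2)%:E < +oo)%E.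
Proof.
move=> b0 /sobolev_summable; apply: le_lt_trans; apply: lee_nneseries => k.
  by move=> _ _; rewrite lee_fin sqr_ge0.
move=> _; rewrite lee_fin ler_peMl ?sqr_ge0//.
by rewrite -[leLHS](powRr0 (lam k)) ler_powR ?lambda_ge1// mulr_ge0.
Qed.

(** Bounds the posterior expectation of the squared Sobolev distance to
    [theta0], with the constants of [integral_sqrB_normal_law_le]. *)
Definition posterior_risk_bound s theta0 n y : \bar R :=
  (\sum_(0 <= k <oo) (lam k `^ (2 * s) *
    (16 / prec n k + 2 * (pmean n y k - coef psi theta0 k) ^+ 2))%:E)%E.

Lemma posterior_risk_bound_term_ge0 s theta0 n y k :
  0 <= lam k `^ (2 * s) *
    (16 / prec n k + 2 * (pmean n y k - coef psi theta0 k) ^+ 2).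
Proof.
have p0 := ltW (precision_gt0 d alpha n k).
apply: mulr_ge0; first exact: powR_ge0.
by apply: addr_ge0; [exact: divr_ge0|rewrite mulr_ge0 ?sqr_ge0].
Qed.

Lemma posterior_risk_bound_ge0 s theta0 n y : (0 <= posterior_risk_bound s theta0 n y)%E.
Proof.
by apply: nneseries_ge0 => k _ _; rewrite lee_fin posterior_risk_bound_term_ge0.
Qed.

(** Since s >= 0 makes all weights at least 1, a finite bound controls the
    squared distance from the posterior means to the coefficients of [theta0]. *)
Lemma posterior_mean_summable s theta0 n y : 0 <= s ->
    (\sum_(0 <= k <oo) (coef psi theta0 k ^+ 2)%:E < +oo)%E ->
    (posterior_risk_bound s theta0 n y < +oo)%E ->
  (\sum_(0 <= k <oo) (pmean n y k ^+ 2)%:E < +oo)%E.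
Proof.
move=> s0 theta0_fin risk_fin.
have sq0 k : (0 <= (coef psi theta0 k ^+ 2)%:E :> \bar R)%E.
  by rewrite lee_fin sqr_ge0.
apply: (@le_lt_trans _ _ (posterior_risk_bound s theta0 n y +
    2%:E * \sum_(0 <= k <oo) (coef psi theta0 k ^+ 2)%:E)%E); last first.
  by rewrite lte_add_pinfty// lte_mul_pinfty// lee_fin.
rewrite -nneseriesZl// -nneseriesD; last 2 first.
- by move=> k _ _; rewrite lee_fin posterior_risk_bound_term_ge0.
- by move=> k _ _; rewrite mule_ge0// lee_fin.
apply: lee_nneseries => [k _ _|k _]; first by rewrite lee_fin sqr_ge0.
rewrite -EFinM -EFinD lee_fin.
have p0 : 0 <= 16 / prec n k by rewrite divr_ge0// ltW// precision_gt0.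
set m := pmean n y k; set c := coef psi theta0 k.
apply: (@le_trans _ _ (2 * (m - c) ^+ 2 + 2 * c ^+ 2)).
  rewrite -subr_ge0 (_ : _ - _ = (m - 2 * c) ^+ 2) ?sqr_ge0//; ring.
rewrite lerD2r; apply: (@le_trans _ _ (16 / prec n k + 2 * (m - c) ^+ 2)).
  by rewrite lerDr.
rewrite ler_peMl//.
  by rewrite addr_ge0// mulr_ge0 ?sqr_ge0.
by rewrite -[leLHS](powRr0 (lam k)) ler_powR ?lambda_ge1// mulr_ge0.
Qed.

(** The normal description of [Q] is assumed only where the posterior means are
    square-summable. By [posterior_mean_summable] this covers every [y] at which
    the right-hand side is finite. *)
Lemma integral_sobolev_sqdist_le s theta0 n y
    (Q : {measure set (L2 R d) -> \bar R}) :
    0 <= s ->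
    (\sum_(0 <= k <oo) (coef psi theta0 k ^+ 2)%:E < +oo)%E ->
    ((\sum_(0 <= k <oo) (pmean n y k ^+ 2)%:E < +oo)%E ->
      independent_normals Q (fun k theta => coef psi theta k) (pmean n y)
        (fun k => Num.sqrt (prec n k)^-1)) ->
  (\int[Q]_theta sobolev_sqdist psi s theta0 theta <= posterior_risk_bound s theta0 n y)%E.
Proof.
move=> s0 theta0_fin Qnormal.
have [risk_fin|] := ltP (posterior_risk_bound s theta0 n y) +oo%E; last first.
  by rewrite leye_eq => /eqP ->; rewrite leey.
have [_ law] := Qnormal (posterior_mean_summable s0 theta0_fin risk_fin).
have msq k : measurable_fun [set: L2 R d]
    (fun theta => ((coef psi theta k - coef psi theta0 k) ^+ 2)%:E).
  by apply/measurable_EFinP/measurable_funX/measurable_funB => //; exact: measurable_coef.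
rewrite integral_nneseries//; last 2 first.
- move=> k; apply/measurable_EFinP/measurable_funM => //.
  by have /measurable_EFinP := msq k.
- by move=> k theta _; rewrite lee_fin mulr_ge0 ?powR_ge0 ?sqr_ge0.
apply: lee_nneseries => k _.
  by move=> _; apply: integral_ge0 => theta _; rewrite lee_fin mulr_ge0 ?powR_ge0 ?sqr_ge0.
under eq_integral do rewrite EFinM.
rewrite ge0_integralZl//; last 2 first.
- by move=> theta _; rewrite lee_fin sqr_ge0.
- by rewrite lee_fin powR_ge0.
rewrite EFinM lee_wpmul2l ?lee_fin ?powR_ge0//.
have pi0 : 0 < (prec n k)^-1 by rewrite invr_gt0 precision_gt0.
have sd0 : 0 < Num.sqrt (prec n k)^-1 by rewrite sqrtr_gt0.
have := integral_sqrB_normal_law_le (coef psi theta0 k) sd0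
  (measurable_coef psi k) (law k).
by rewrite sqr_sqrtr// ltW.
Qed.

Lemma measurable_sobolev_tail s r theta0 : 0 <= r ->
  measurable [set theta : L2 R d |
    (r%:E < sobolev_norm psi s (fun x => (theta x - theta0 x)%R))%E].
Proof.
move=> r0; rewrite (_ : [set _ | _] =
    [set: L2 R d] `&` [set theta | ((r ^+ 2)%:E < sobolev_sqdist psi s theta0 theta)%E]).
  by apply: emeasurable_fun_o_infty => //; exact: measurable_sobolev_sqdist.
by rewrite setTI; apply/seteqP; split => theta /=; rewrite sobolev_norm_gtE.
Qed.

Lemma sobolev_tail_le s r theta0 (Q : {measure set (L2 R d) -> \bar R}) :
  0 < r ->
  (Q [set theta : L2 R d |
       (r%:E < sobolev_norm psi s (fun x => (theta x - theta0 x)%R))%E]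
   <= (r ^- 2)%:E * \int[Q]_theta sobolev_sqdist psi s theta0 theta)%E.
Proof.
move=> r0; have r20 : 0 < r ^+ 2 by rewrite exprn_gt0.
rewrite lee_pdivlMl//.
have msq := measurable_sobolev_sqdist psi s theta0.
have := @le_integral_comp_abse _ _ _ Q _ measurableT _ _ id
  (@measurable_id _ _ _) (fun _ => id) (fun _ _ _ _ => id) msq r20.
under eq_integral do rewrite gee0_abs ?sobolev_sqdist_ge0//.
apply: le_trans; apply: lee_wpmul2l; first by rewrite lee_fin ltW.
apply: le_measure; rewrite ?inE.
- by apply: measurable_sobolev_tail; exact: ltW.
- by apply: emeasurable_fun_c_infty => //; exact: measurableT_comp.
- move=> theta /=; rewrite (sobolev_norm_gtE _ _ _ _ (ltW r0)) => /ltW ?; split=> //.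
  by rewrite gee0_abs ?sobolev_sqdist_ge0.
Qed.

End posterior_risk.

(** * Expectation over the observations *)

Section expected_risk.
Context (R : realType) (d : nat) (d_gt0 : (0 < d)%N) (psi : nat -> L2 R d)
  (alpha : R).
Context (dW : measure_display) (W : measurableType dW) (P : probability W R)
  (Z : nat -> {RV P >-> R}).
Local Notation lam := (lambda R d).
Local Notation prec := (precision d alpha).

Lemma measurable_observation n (theta0 : L2 R d) :
  measurable_fun [set: W] (observation psi Z n theta0).
Proof.
apply: (@measurability _ _ W (Rseq R) setT (observation psi Z n theta0)
  (@sequence_cylinders R)) => //.
move=> _ [_ [k [B [mB ->]] <-]].
have mobs : measurable_fun [set: W]
    (fun w => coef psi theta0 k + (Num.sqrt n%:R)^-1 * Z k w).
  by apply: measurable_funD => //; exact: measurable_funM.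
exact: (mobs measurableT B mB).
Qed.

(** Bias and noise are merged into a recentred noise variable, so that the
    mean squared error is a single second moment of [Z k] about a point. *)
Lemma posterior_mean_observationB n (theta0 : L2 R d) w k : (0 < n)%N ->
  posterior_mean d alpha n (observation psi Z n theta0 w) k - coef psi theta0 k =
  Num.sqrt n%:R / prec n k *
  (Z k w - (prec n k - n%:R) * coef psi theta0 k / Num.sqrt n%:R).
Proof.
move=> n0; rewrite /posterior_mean /observation.
have p0 : prec n k != 0 by rewrite gt_eqF// precision_gt0.
move: (prec n k) p0 => p p0.
have : Num.sqrt n%:R != 0 :> R by rewrite gt_eqF// sqrtr_gt0 ltr0n.
have : n%:R = Num.sqrt n%:R ^+ 2 :> R by rewrite sqr_sqrtr.
move: (Num.sqrt n%:R) => q -> q0.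
by field; rewrite q0 p0.
Qed.

Lemma measurable_posterior_mean_sqrB n (theta0 : L2 R d) k : (0 < n)%N ->
  measurable_fun [set: W] (fun w => (posterior_mean d alpha n
    (observation psi Z n theta0 w) k - coef psi theta0 k) ^+ 2).
Proof.
move=> n0; under eq_fun do rewrite posterior_mean_observationB//.
by apply/measurable_funX/measurable_funM => //; exact: measurable_funB.
Qed.

Lemma measurable_posterior_risk_bound s n (theta0 : L2 R d) : (0 < n)%N ->
  measurable_fun [set: W] (fun w =>
    posterior_risk_bound psi alpha s theta0 n (observation psi Z n theta0 w)).
Proof.
move=> n0; apply: ge0_emeasurable_sum => k.
  by move=> w _ _; rewrite lee_fin posterior_risk_bound_term_ge0.
move=> _; apply/measurable_EFinP/measurable_funM => //.
apply/measurable_funD => //; apply/measurable_funM => //.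
exact: measurable_posterior_mean_sqrB.
Qed.

Hypothesis Z_iid : iid_std_normal Z.

(** The noise contributes 16 n / p_k^2, bounded through n <= p_k by a multiple of
    the posterior variance 1 / p_k. *)
Lemma integral_posterior_mean_sqrB_le n (theta0 : L2 R d) k : (0 < n)%N ->
  (\int[P]_w ((posterior_mean d alpha n (observation psi Z n theta0 w) k -
               coef psi theta0 k) ^+ 2)%:E
   <= (16 / prec n k + 2 * ((lam k `^ (2 * alpha + d%:R) / prec n k) ^+ 2 *
                            coef psi theta0 k ^+ 2))%:E)%E.
Proof.
move=> n0; under eq_integral do rewrite posterior_mean_observationB// exprMn EFinM.
have p0 := precision_gt0 d alpha n k.
have n0R : 0 < n%:R :> R by rewrite ltr0n.
have q0 : 0 < Num.sqrt n%:R :> R by rewrite sqrtr_gt0.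
set c := _ * _ / Num.sqrt n%:R.
rewrite ge0_integralZl//; last 3 first.
- apply/measurable_EFinP/measurable_funX/measurable_funB => //.
- by move=> w _; rewrite lee_fin sqr_ge0.
- by rewrite lee_fin sqr_ge0.
have law A (mA : measurable A) := Z_iid.2 k A mA.
have mZ : measurable_fun [set: W] (Z k) by [].
apply: le_trans.
  apply: lee_wpmul2l; first by rewrite lee_fin sqr_ge0.
  exact: (integral_sqrB_normal_law_le c ltr01 mZ law).
rewrite -EFinM lee_fin sub0r sqrrN expr1n mulr1 mulrDr lerD//.
  rewrite expr_div_n sqr_sqrtr ?(ltW n0R)// mulrC ler_pM2l//.
  rewrite ler_pdivrMr ?exprn_gt0// expr2 mulrA mulVf ?gt_eqF// mul1r.
  exact: le_precision.
rewrite /c /precision [n%:R + _ - n%:R]addrC addKr -/(prec n k).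
rewrite le_eqVlt; apply/orP; left; apply/eqP.
by field; rewrite !gt_eqF.
Qed.

(** Each term is at most 48 times a variance term plus 4 times a bias term; the
    variance rate is no worse than the bias rate because gamma <= alpha. *)
Lemma integral_posterior_risk_bound_le beta s (theta0 : L2 R d) :
    0 <= s -> s < Num.min alpha beta -> sobolev psi beta theta0 ->
  exists2 C : R, 0 <= C & forall n, (0 < n)%N ->
    (\int[P]_w posterior_risk_bound psi alpha s theta0 n (observation psi Z n theta0 w)
     <= (C * n%:R `^ (- (2 * ((Num.min alpha beta - s) / (2 * alpha + d%:R)))))%:E)%E.
Proof.
move=> s0 sg theta0_beta.
set g := Num.min alpha beta.
pose rate n : R := n%:R `^ (- (2 * ((g - s) / (2 * alpha + d%:R)))).
have sa : s < alpha by apply: lt_le_trans sg _; rewrite ge_min lexx.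
have a0 : 0 < 2 * alpha + d%:R by rewrite addr_gt0 ?ltr0n//; lra.
have [C C0 varC] := posterior_variance_series_le d_gt0 s0 sa.
pose B := (\sum_(0 <= k <oo) (lam k `^ (2 * beta) * coef psi theta0 k ^+ 2)%:E)%E.
have B0 : (0 <= B)%E.
  by apply: nneseries_ge0 => k _ _; rewrite lee_fin mulr_ge0 ?powR_ge0 ?sqr_ge0.
have Bfin : B \is a fin_num.
  by rewrite ge0_fin_numE//; exact: sobolev_summable theta0_beta.
(* 48 = 16 + 2 * 16 and 4 = 2 * 2 *)
exists (48 * C + 4 * fine B).
  by rewrite addr_ge0// mulr_ge0// fine_ge0.
move=> n n0; have n1 : 1 <= n%:R :> R by rewrite ler1n.
pose v k := lam k `^ (2 * s) / prec n k.
pose b k := lam k `^ (2 * beta) * coef psi theta0 k ^+ 2.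
have v0 k : 0 <= v k by rewrite divr_ge0 ?powR_ge0// ltW// precision_gt0.
have b0 k : 0 <= b k by rewrite mulr_ge0 ?powR_ge0 ?sqr_ge0.
have rate0 : 0 <= rate n by exact: powR_ge0.
rewrite -/(rate n); apply: (@le_trans _ _ (48%:E * (\sum_(0 <= k <oo) (v k)%:E) +
    (4 * rate n)%:E * \sum_(0 <= k <oo) (b k)%:E)%E); last first.
  rewrite -/B -(fineK Bfin) -EFinM.
  rewrite [X in (_ <= X%:E)%E](_ : _ = 48 * (C * rate n) + 4 * rate n * fine B);
    last by ring.
  rewrite [leRHS]EFinD leeD2r// [leRHS]EFinM lee_pmul2l//.
  apply: le_trans (varC n n0) _; rewrite lee_fin ler_wpM2l//.
  rewrite ler_powR// lerN2 ler_pM2l// ler_pM2r ?invr_gt0// lerB//.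
  by rewrite ge_min lexx.
rewrite -[X in (_ <= X + _)%E]nneseriesZl; last by move=> k _; rewrite lee_fin.
rewrite -[X in (_ <= _ + X)%E]nneseriesZl; last by move=> k _; rewrite lee_fin.
rewrite -nneseriesD; last 2 first.
- by move=> k _ _; rewrite -EFinM lee_fin mulr_ge0.
- by move=> k _ _; rewrite -EFinM lee_fin; apply: mulr_ge0 => //; exact: mulr_ge0.
have mterm k := measurable_posterior_mean_sqrB theta0 k n0.
rewrite integral_nneseries//; last 2 first.
- move=> k; apply/measurable_EFinP/measurable_funM => //.
  by apply/measurable_funD => //; exact/measurable_funM.
- by move=> k w _; rewrite lee_fin posterior_risk_bound_term_ge0.
apply: lee_nneseries => k.
  by move=> _ _; apply: integral_ge0 => w _; rewrite lee_fin posterior_risk_bound_term_ge0.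
move=> _; have p0 := precision_gt0 d alpha n k.
under eq_integral do
  rewrite EFinM EFinD [X in (_ * (_ + X))%E]EFinM.
rewrite ge0_integralZl//; last 3 first.
- by apply: emeasurable_funD => //; apply: emeasurable_funM => //; exact/measurable_EFinP.
- move=> w _; rewrite -EFinM -EFinD lee_fin; apply: addr_ge0.
    exact: divr_ge0 (ltW p0).
  by rewrite mulr_ge0 ?sqr_ge0.
- by rewrite lee_fin powR_ge0.
rewrite ge0_integralD//; last 3 first.
- by move=> w _; rewrite lee_fin divr_ge0 ?(ltW p0).
- by move=> w _; rewrite -EFinM lee_fin mulr_ge0 ?sqr_ge0.
- by apply: emeasurable_funM => //; exact/measurable_EFinP.
rewrite ge0_integralZl//; last 2 first.
- exact/measurable_EFinP.
- by move=> w _; rewrite lee_fin sqr_ge0.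
rewrite [X in (_ * (X + _) <= _)%E](integral_cst _ measurableT (16 / prec n k)%:E).
rewrite [X in (_ * (_ * X + _) <= _)%E](_ : _ = 1%E);
  last exact: (probability_setT P).
rewrite mule1.
apply: (@le_trans _ _ ((lam k `^ (2 * s))%:E * ((16 / prec n k)%:E +
    2%:E * (16 / prec n k + 2 * ((lam k `^ (2 * alpha + d%:R) / prec n k) ^+ 2 *
                                 coef psi theta0 k ^+ 2))%:E))%E).
  apply: lee_wpmul2l; first by rewrite lee_fin powR_ge0.
  by apply/leeD2l/lee_wpmul2l => //; exact: integral_posterior_mean_sqrB_le.
rewrite -!(EFinM, EFinD) lee_fin.
set th := coef psi theta0 k ^+ 2; set z := (_ / _) ^+ 2.
rewrite [leLHS](_ : _ = 48 * v k + 4 * (lam k `^ (2 * s) * z * th)); last first.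
  by rewrite /v; ring.
rewrite lerD2l [leRHS](_ : _ = 4 * (lam k `^ (2 * beta) * rate n * th));
  last by rewrite /b -/th; ring.
rewrite ler_pM2l// ler_wpM2r ?sqr_ge0//.
exact: weighted_bias_le.
Qed.

End expected_risk.

(** * Posterior contraction *)

Theorem theorem4p3 (R : realType) (d : nat) (d_gt0 : (0 < d)%N)
  (S : nat) (psi : nat -> L2 R d) (psi_wavelet : wavelet_basis S psi)
  (alpha beta : R) (alpha_gt0 : 0 < alpha) (beta_gt0 : 0 < beta)
  (theta0 : L2 R d) (theta0_sobolev : sobolev psi beta theta0)
  (Pi : probability (L2 R d) R) (Pi_prior : gaussian_series_prior psi alpha Pi)
  (dW : measure_display) (W : measurableType dW) (P : probability W R)
  (Z : nat -> {RV P >-> R}) (Z_iid : iid_std_normal Z)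
  (post : nat -> R.-pker (Rseq R) ~> (L2 R d))
  (post_posterior : forall n, (0 < n)%N -> posterior psi alpha Z Pi n (post n))
  (s : R) (s_ge0 : 0 <= s) (s_lt : s < Num.min alpha beta)
  (M : nat -> R) (M_infty : M n @[n --> \oo] --> +oo) :
  (\int[P]_w post n (observation psi Z n theta0 w)
     [set theta : L2 R d |
        sobolev_norm psi s (fun x => (theta x - theta0 x)%R) >
        (M n * n%:R `^ (- ((Num.min alpha beta - s) / (2 * alpha + d%:R))))%:E])%E
  @[n --> \oo] --> 0%E.
Proof.
set g := Num.min alpha beta in s_lt *.
set kap := (g - s) / (2 * alpha + d%:R).
have [C C0 riskC] :=
  integral_posterior_risk_bound_le d_gt0 Z_iid s_ge0 s_lt theta0_sobolev.
have theta0_fin := sobolev_coef_sqr_summable (ltW beta_gt0) theta0_sobolev.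
pose tail n : set (L2 R d) := [set theta |
  ((M n * n%:R `^ (- kap))%:E <
   sobolev_norm psi s (fun x => (theta x - theta0 x)%R))%E].
have bound n : (0 < n)%N -> 1 <= M n ->
    (\int[P]_w post n (observation psi Z n theta0 w) (tail n) <=
     (C * (M n)^-1)%:E)%E.
  move=> n0 M1; have M0 : 0 < M n by exact: lt_le_trans M1.
  have n0R : 0 < n%:R :> R by rewrite ltr0n.
  set r := M n * n%:R `^ (- kap).
  have r0 : 0 < r by rewrite mulr_gt0// powR_gt0.
  have mobs := measurable_observation psi Z n theta0.
  have mrisk : measurable_fun [set: W] (fun w =>
      posterior_risk_bound psi alpha s theta0 n (observation psi Z n theta0 w)).
    exact: measurable_posterior_risk_bound.
  have mtail : measurable (tail n) by apply: measurable_sobolev_tail; exact: ltW.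
  apply: (@le_trans _ _ (\int[P]_w ((r ^- 2)%:E *
      posterior_risk_bound psi alpha s theta0 n (observation psi Z n theta0 w)))%E).
    apply: ge0_le_integral => //.
    - apply: (measurableT_comp (measurable_kernel (post n) _ mtail) mobs).
    - exact: emeasurable_funM.
    - move=> w _; apply: le_trans (sobolev_tail_le psi s theta0 _ r0) _.
      apply: lee_wpmul2l; first by rewrite lee_fin invr_ge0 sqr_ge0.
      apply: integral_sobolev_sqdist_le => //.
      exact: (post_explicit (post_posterior n n0)).
  rewrite ge0_integralZl//; last 2 first.
  - by move=> w _; exact: posterior_risk_bound_ge0.
  - by rewrite lee_fin invr_ge0 sqr_ge0.
  apply: le_trans (lee_wpmul2l _ (riskC n n0)) _.
    by rewrite lee_fin invr_ge0 sqr_ge0.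
  rewrite -EFinM lee_fin -/g -/kap.
  (* the rate cancels against that of the squared radius *)
  have -> : n%:R `^ (- (2 * kap)) = (n%:R `^ (- kap)) ^+ 2.
    by rewrite -powR_mulrn ?powR_ge0// -powRrM mulNr [kap * 2]mulrC.
  set u := n%:R `^ (- kap); have u0 : u != 0 by rewrite gt_eqF// powR_gt0.
  rewrite [leLHS](_ : _ = C * (M n)^-1 * (M n)^-1); last first.
    by rewrite /r -/u; field; rewrite u0 gt_eqF.
  (* M n >= 1 replaces the inverse square of M n by its inverse *)
  rewrite -[leRHS]mulr1 ler_wpM2l ?mulr_ge0 ?invr_ge0 ?(ltW M0)//.
  by rewrite invf_le1.
have M1 : \forall n \near \oo, 1 <= M n by move/cvgryPge : M_infty; exact.
apply: (@squeeze_cvge _ _ _ _ (cst 0%E) _ (fun n => (C * (M n)^-1)%:E)).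
- near=> n; apply/andP; split; first by apply: integral_ge0.
  by apply: bound; near: n => //; exact: nbhs_infty_gt.
- exact: cvg_cst.
- apply: cvg_EFin; first exact: nearW.
  rewrite -[0]/(0 : R) -(mulr0 C); apply: cvgMl_tmp.
  apply/gtr0_cvgV0 => //.
  by near=> n; apply: lt_le_trans ltr01 _; near: n.
Unshelve. all: by end_near.
Qed.
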